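(* Let $c,d,\nu$ be positive numbers satisfying $c\ge 8\nu$ and $d\ge 4\nu$. Let $G$ be a graph of order $n$ with minimum degree $\delta(G)\ge(1/2+c)n$. Assume that the edges of $G$ are labelled by either $+1$ or $-1$, via $f:E(G)\to\{-1,1\}$, such that the number of $\nu$-balanced vertices is at least $(3/4+d)n$. Then there exists a Hamilton cycle $H$ in $G$ with discrepancy at least $\nu^2n/500$, i.e. $\left|\sum_{e\in E(H)}f(e)\right|\ge \nu^2 n/500$.
   Context: All graphs are finite and simple. Given a graph $G$ on $n$ vertices with an edge labeling $f:E(G)\to\{-1,1\}$ and a real number $\nu>0$, a vertex is $\nu$-balanced if it is incident to at least $\nu n$ edges with label $+1$ and to at least $\nu n$ edges with label $-1$. The discrepancy of a subgraph $H$ is the absolute value of the sum of the labels of its edges. *)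

(* Defs.v *)
From mathcomp Require Import all_boot all_order all_algebra.
From mathcomp Require Import reals.

Set Implicit Arguments.
Unset Strict Implicit.
Unset Printing Implicit Defensive.

Import Order.TTheory GRing.Theory Num.Theory.
Local Open Scope ring_scope.

(* A finite simple graph on V is given by its adjacency relation, assumed
   symmetric and irreflexive wherever it is used. *)

Definition edges (V : finType) (adj : rel V) : {set {set V}} :=
  [set [set p.1; p.2] | p : V * V & adj p.1 p.2].

Definition degree (V : finType) (adj : rel V) (v : V) : nat :=
  #|[set u | adj v u]|.

(* The neutral value #|V| exceeds every degree, so this is the true minimum
   as soon as V is nonempty. *)
Definition min_degree (V : finType) (adj : rel V) : nat :=
  \big[minn/#|V|]_(v : V) degree adj v.

(* A labelling E(G) -> {-1, 1} is represented by a function on all vertex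
   sets, of which only the values on edges matter. *)
Definition edge_labelling (V : finType) (adj : rel V) (f : {set V} -> int) :
    Prop :=
  forall e : {set V}, e \in edges adj -> f e = - 1 \/ f e = 1.

Definition label_degree (V : finType) (adj : rel V) (f : {set V} -> int)
    (a : int) (v : V) : nat :=
  #|[set e in edges adj | (v \in e) && (f e == a)]|.

Definition balanced (R : realType) (V : finType) (adj : rel V)
    (f : {set V} -> int) (nu : R) (v : V) : bool :=
  (nu * #|V|%:R <= (label_degree adj f 1 v)%:R) &&
  (nu * #|V|%:R <= (label_degree adj f (- 1) v)%:R).

(* [ucycleb] also accepts the empty sequence and the closed walk of length two
   along a single edge. *)
Definition hamilton_cycle (V : finType) (adj : rel V) (s : seq V) : bool :=
  [&& (2 < size s)%N, ucycleb adj s & [forall v, v \in s]].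

Definition cycle_edges (V : finType) (s : seq V) : {set {set V}} :=
  [set [set x; next s x] | x in s].

Definition discrepancy (V : finType) (f : {set V} -> int)
    (F : {set {set V}}) : int :=
  `| \sum_(e in F) f e |.

(* Main.v *)
Require Import Defs.
From mathcomp Require Import all_boot all_order all_algebra.
From mathcomp Require Import reals.
From mathcomp Require Import zify ring lra.

Set Implicit Arguments.
Unset Strict Implicit.
Unset Printing Implicit Defensive.

Import Order.TTheory GRing.Theory Num.Theory.
Local Open Scope ring_scope.

(* Inserting a vertex v into an edge xy of a cycle changes the label sum by the
   gain f(vx) + f(vy) - f(xy).  A switch is a vertex v with two edges in its
   neighbourhood having different gains.

   If there are K disjoint switches, with K about nu^2 n / 250, then Posa's
   theorem gives a cycle through both edges of all K switches that misses only
   their centres; inserting the centres in the two ways gives two Hamilton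
   cycles whose sums differ by at least K.

   Otherwise fewer than 5 K vertices meet all switches.  Away from them the gain
   at v is a constant g v, so that 2 f(xy) = g x + g y; balanced vertices have
   g = 1 or g = -1, the same value for all of them because any two have a common
   neighbour.  Hence all edges between balanced vertices have the same label,
   and more than half of the edges of any Hamilton cycle are of this kind.

   Posa's theorem needs 2 delta >= n + 3 K, which can fail only for K = 1.  Then
   it suffices to find a nonzero sum, which is automatic for odd n.  For even n
   we have 2 delta >= n + 2, and if all Hamilton cycles have the same sum then
   there is no switch: for an edge xy in the neighbourhood of v, a Hamilton
   cycle C of G - v can be transformed by two 2-opt moves into one through xy
   that still shares with C an edge in the neighbourhood of v. *)

(** * Edges of paths and closed walks *)

(** Steps are listed with multiplicity and need not be edges of the graph. An exchange of edges is
    then a [perm_eq] of lists, provable by counting. *)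
Fixpoint pedges (V : finType) (x : V) (p : seq V) : seq {set V} :=
  if p is y :: q then [set x; y] :: pedges y q else [::].

Definition cedges (V : finType) (s : seq V) : seq {set V} :=
  if s is x :: p then pedges x (rcons p x) else [::].

Lemma set2C (V : finType) (x y : V) : [set x; y] = [set y; x].
Proof. by rewrite setUC. Qed.

Lemma set2_inj (V : finType) (a b x y : V) :
  [set a; b] = [set x; y] -> a = x /\ b = y \/ a = y /\ b = x.
Proof.
move=> E; have /set2P[Ea|Ea] : a \in [set x; y] by rewrite -E set21.
  have /set2P[Eb|Eb] : b \in [set x; y] by rewrite -E set22.
    have /set2P[|] : y \in [set a; b] by rewrite E set22.
      by left; split=> //; congruence.
    by left; split=> //; congruence.
  by left.
have /set2P[Eb|Eb] : b \in [set x; y] by rewrite -E set22.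
  by right.
have /set2P[|] : x \in [set a; b] by rewrite E set21.
  by right; split=> //; congruence.
by right; split=> //; congruence.
Qed.

Lemma pedges_cat (V : finType) (x : V) p q :
  pedges x (p ++ q) = pedges x p ++ pedges (last x p) q.
Proof. by elim: p x => //= y p IH x; rewrite IH. Qed.

Lemma pedges_rcons (V : finType) (x y : V) p :
  pedges x (rcons p y) = rcons (pedges x p) [set last x p; y].
Proof. by rewrite -cats1 pedges_cat cats1. Qed.

Lemma size_pedges (V : finType) (x : V) p : size (pedges x p) = size p.
Proof. by elim: p x => //= y p IH x; rewrite IH. Qed.

Lemma size_cedges (V : finType) (s : seq V) : size (cedges s) = size s.
Proof. by case: s => //= x p; rewrite size_pedges size_rcons. Qed.

Lemma pedges_rev (V : finType) (x : V) p :
  pedges (last x p) (rev (belast x p)) = rev (pedges x p).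
Proof.
elim: p x => //= y p IH x.
rewrite !rev_cons pedges_rcons IH; congr rcons; rewrite set2C; congr [set _; _].
by case: p {IH} => //= z p; rewrite rev_cons last_rcons.
Qed.

Lemma cedges_cat (V : finType) (x y : V) p q :
  cedges ((x :: p) ++ (y :: q)) =
  pedges x p ++ [set last x p; y] :: pedges y q ++ [:: [set last y q; x]].
Proof.
by rewrite /= rcons_cat pedges_cat /= pedges_rcons cats1.
Qed.

Lemma cedges_catC (V : finType) (s t : seq V) :
  perm_eq (cedges (s ++ t)) (cedges (t ++ s)).
Proof.
case: s t => [|x p] [|y q]; rewrite ?cats0 //.
rewrite !cedges_cat.
by apply/permP => P; rewrite !count_cat /= ?count_cat /=; lia.
Qed.

(** Rotation turns any chosen step into the closing one, so exchanges and insertions need only be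
    described there. *)
Lemma cedges_rotate (V : finType) (s : seq V) e :
  e \in cedges s ->
  exists a p, [/\ perm_eq (a :: p) s, perm_eq (cedges (a :: p)) (cedges s)
                & e = [set last a p; a]].
Proof.
have split_pedges x p : e \in pedges x p ->
    exists p1 y p2, p = p1 ++ y :: p2 /\ e = [set last x p1; y].
  elim: p x => //= y p IH x; rewrite inE => /predU1P[->|/IH].
    by exists [::], y, p.
  by move=> [p1 [z [p2 [-> ->]]]]; exists (y :: p1), z, p2.
case: s => //= x p /split_pedges[p1 [y [p2 [Ep Ee]]]].
case/lastP: p2 Ep => [|p2 z].
  by rewrite cats1 => /rcons_inj[? ?]; subst x p; exists y, p1.
rewrite -rcons_cons -rcons_cat => /rcons_inj[-> _].
exists y, (p2 ++ x :: p1); split; last by rewrite last_cat.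
  by rewrite -!cat_cons perm_catC.
exact: (cedges_catC (y :: p2) (x :: p1)).
Qed.

Lemma mem_pedges (V : finType) (x u : V) p e :
  e \in pedges x p -> u \in e -> u \in x :: p.
Proof.
elim: p x => //= y p IH x; rewrite inE => /predU1P[->|/IH H /H].
  by rewrite !inE => /orP[]/eqP->; rewrite eqxx ?orbT.
by rewrite !inE => ->; rewrite orbT.
Qed.

Lemma pedges_uniq (V : finType) (x : V) p : uniq (x :: p) -> uniq (pedges x p).
Proof.
elim: p x => //= y p IH x /andP[xN yp].
rewrite IH // andbT; apply: contra xN => /mem_pedges; apply.
by rewrite set21.
Qed.

(** A closed walk on two vertices lists its edge twice, hence the size bound. *)
Lemma cedges_uniq (V : finType) (s : seq V) :
  uniq s -> (2 < size s)%N -> uniq (cedges s).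
Proof.
case: s => [|x [|y [|z p]]] // U _.
rewrite [cedges _](_ : _ = rcons (pedges x [:: y, z & p]) [set last z p; x]);
  last by rewrite /= pedges_rcons.
rewrite rcons_uniq pedges_uniq // andbT; move: U.
set q := z :: p; rewrite [pedges _ _]/= -/(pedges y q) inE negb_or => U.
move: U; rewrite /= -/q => /andP[xN /andP[yN _]].
apply/andP; split; last first.
  apply/negP => H; have := @mem_pedges V y x q _ H; rewrite set22 => /(_ isT).
  by rewrite (negPf xN).
apply/eqP => /set2_inj[[H1 H2]|[H1 _]].
  by move: xN; rewrite H2 inE eqxx.
by move: yN; rewrite -H1 /q mem_last.
Qed.

Lemma path_pedges (V : finType) (adj : rel V) (x : V) p :
  symmetric adj -> irreflexive adj ->
  path adj x p = all [in edges adj] (pedges x p).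
Proof.
move=> adjC adjI; elim: p x => //= y p IH x; rewrite IH; congr (_ && _).
apply/idP/imsetP => [xy|[[a b] /=]]; first by exists (x, y); rewrite ?inE.
by rewrite inE /= => ab /set2_inj[[-> ->]|[-> ->]] //; rewrite adjC.
Qed.

Lemma edgesP (V : finType) (adj : rel V) (x y : V) :
  symmetric adj -> irreflexive adj -> ([set x; y] \in edges adj) = adj x y.
Proof.
move=> adjC adjI; have := path_pedges x [:: y] adjC adjI.
by rewrite /= !andbT => ->.
Qed.

Lemma cycle_cedges (V : finType) (adj : rel V) (s : seq V) :
  symmetric adj -> irreflexive adj ->
  cycle adj s = all [in edges adj] (cedges s).
Proof. by case: s => //= x p *; rewrite path_pedges. Qed.

Lemma cycle_edgesE (V : finType) (s : seq V) :
  uniq s -> cycle_edges s = [set e in cedges s].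
Proof.
have map_next y0 y p : uniq (y :: p) ->
    [seq [set x; next_at x y0 y p] | x <- y :: p] = pedges y (rcons p y0).
  elim: p y => [|z q IH] y; first by rewrite /= eqxx.
  rewrite cons_uniq => /andP[yN U]; rewrite rcons_cons [RHS]/= -IH //.
  rewrite map_cons [X in [set y; X]]/= eqxx; congr cons.
  apply/eq_in_map => x xin /=; case: eqP => // E.
  by move: yN; rewrite -E xin.
case: s => [|x p] U.
  by apply/setP => e; rewrite !inE; apply/imsetP => -[].
rewrite [cedges _]/= -map_next //; apply/setP => e; rewrite inE.
by apply/imsetP/mapP => -[y yin ->]; exists y.
Qed.

(** Reversing the first segment keeps its inner steps and changes only the two links to the second
    one. The removed links stand on the left and the new ones on the right, which avoids subtracting
    from multisets. *)
Lemma two_opt (V : finType) (a y : V) p q :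
  perm_eq ([set last a p; y] :: [set last y q; a]
             :: cedges (rev (a :: p) ++ (y :: q)))
          ([set a; y] :: [set last y q; last a p]
             :: cedges ((a :: p) ++ (y :: q))).
Proof.
have -> : rev (a :: p) = last a p :: rev (belast a p).
  by rewrite lastI rev_rcons.
rewrite !cedges_cat pedges_rev.
have -> : last (last a p) (rev (belast a p)) = a.
  by case: p => //= b p; rewrite rev_cons last_rcons.
by apply/permP => P; rewrite /= !(count_cat, count_rev) /= !count_cat /=; lia.
Qed.

Lemma insert_edge (V : finType) (s : seq V) (v x y : V) :
  [set x; y] \in cedges s ->
  exists t, perm_eq t (v :: s) /\
    perm_eq ([set x; y] :: cedges t) ([set v; x] :: [set v; y] :: cedges s).
Proof.
move=> /cedges_rotate[a [p [sP eP E]]]; exists (v :: a :: p); split.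
  by rewrite perm_cons.
apply/permP => P; have := permP eP P.
rewrite /= !pedges_rcons -!cats1 !count_cat /= ?count_cat /= E.
have -> : [set last a p; v] = [set v; last a p] by exact: set2C.
by case/set2_inj: E => -[-> ->] /=; lia.
Qed.

(** A step has at most one end in [P] unless it lies inside [P]; sum this over all steps. *)
Lemma count_pedges (V : finType) (P : {set V}) (x : V) p :
  (count (mem P) (belast x p) + count (mem P) p <=
   size p + count (fun e : {set V} => e \subset P) (pedges x p))%N.
Proof.
elim: p x => //= y p IH x; have := IH y; rewrite subUset !sub1set.
by case: (x \in P); case: (y \in P) => /=; lia.
Qed.

Lemma count_cedges (V : finType) (P : {set V}) (s : seq V) :
  (2 * count (mem P) s <=
   size s + count (fun e : {set V} => e \subset P) (cedges s))%N.
Proof.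
case: s => //= x p; have := count_pedges P x (rcons p x).
by rewrite belast_rcons size_rcons -cats1 count_cat /=; lia.
Qed.

(** * Posa's theorem *)

(** Pigeonhole: if every step whose head satisfies [A] and whose tail satisfies [B] were in [F], the
    two counts together could not exceed the number of steps plus the number of steps in [F]. *)
Lemma crossing_edge (V : finType) (A B : pred V) (F : seq {set V}) x p :
  (size p + count [in F] (pedges x p) < count A p + count B (belast x p))%N ->
  exists p1 y p2,
    [/\ p = p1 ++ y :: p2, A y, B (last x p1) & [set last x p1; y] \notin F].
Proof.
elim: p x => //= y p IH x lt.
case Ay: (A y) lt => /=; case Bx: (B x) => /=; case eF: (_ \in F) => /= lt;
  try by [exists [::], y, p; rewrite eF].
all: have {}lt : (size p + count [in F] (pedges y p) <
                    count A p + count B (belast y p))%N by move: lt => /=; lia.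
all: by have [p1 [z [p2 [-> Az Bl eN]]]] := IH _ lt; exists (y :: p1), z, p2.
Qed.

(** Rotate the nonedge [e0] into the closing step from [b] to [a]. The degree bound gives a step
    [zy] outside [F] with [a] adjacent to [y] and [b] adjacent to [z]; 2-opt trades [ba] and [zy]
    for the edges [ay] and [bz]. *)
Lemma two_opt_step (V : finType) (adj : rel V) (F : seq {set V}) s e0 :
  symmetric adj -> irreflexive adj -> uniq s ->
  (forall x, x \in s -> size s + size F <= 2 * count (adj x) s)%N ->
  e0 \in cedges s -> e0 \notin edges adj ->
  exists t e1 g1 g2,
    [/\ perm_eq t s, e1 \in cedges s /\ e1 \notin F,
        g1 \in edges adj, g2 \in edges adj &
        perm_eq (e0 :: e1 :: cedges t) (g1 :: g2 :: cedges s)].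
Proof.
move=> adjC adjI Us deg /cedges_rotate[a [p [sP eP ->]]].
rewrite edgesP // => ba.
have U : uniq (a :: p) by rewrite (perm_uniq sP).
have sz : size s = (size p).+1 by rewrite -(perm_size sP).
have dega : (size s + size F <= 2 * count (adj a) p)%N.
  have := deg a; rewrite -(perm_mem sP) mem_head -(permP sP) /= adjI.
  by rewrite add0n; apply.
have degb : (size s + size F <= 2 * count (adj (last a p)) (belast a p))%N.
  have := deg (last a p); rewrite -(perm_mem sP) mem_last -(permP sP).
  by rewrite lastI -cats1 count_cat /= adjI !addn0; apply.
have cF : (count [in F] (pedges a p) <= size F)%N.
  rewrite -size_filter uniq_leq_size ?filter_uniq ?pedges_uniq //.
  by move=> e; rewrite mem_filter => /andP[].
have [|p1 [y [p2 [Ep ay lx eN]]]] :=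
    @crossing_edge V (adj a) (adj (last a p)) F a p.
  have half m k i j : (m <= 2 * i -> m <= 2 * j -> k < m -> k < i + j)%N by lia.
  by apply: half dega degb _; rewrite sz ltnS leq_add2l.
have /= opt := two_opt a y p1 p2.
have last_p : last y p2 = last a p by rewrite Ep last_cat.
exists (rev (a :: p1) ++ y :: p2), [set last a p1; y], [set a; y].
exists [set last y p2; last a p1]; split.
- by apply: perm_trans sP; rewrite Ep -cat_cons perm_cat2r perm_rev.
- split=> //; rewrite -(perm_mem eP) Ep -cat_cons cedges_cat mem_cat inE eqxx.
  by rewrite orbT.
- by rewrite edgesP.
- by rewrite edgesP // last_p.
rewrite -last_p; apply: perm_trans (_ : perm_eq _ ([set a; y] ::
  [set last y p2; last a p1] :: cedges ((a :: p1) ++ y :: p2))) _; last first.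
  by rewrite !perm_cons cat_cons -Ep.
apply: perm_trans opt; apply/permP => P /=; lia.
Qed.

(** Start from a closed walk that contains [F] but may use nonedges. Each exchange step lowers the
    number of nonedges and spares [F], whose members are edges of the graph. *)
Lemma posa_cycle (V : finType) (adj : rel V) (F : seq {set V}) s :
  symmetric adj -> irreflexive adj -> uniq s ->
  (forall x, x \in s -> size s + size F <= 2 * count (adj x) s)%N ->
  {subset F <= edges adj} -> {subset F <= cedges s} ->
  exists t, [/\ perm_eq t s, cycle adj t & {subset F <= cedges t}].
Proof.
move=> adjC adjI; move Ek: (count (fun e => e \notin edges adj) (cedges s)) => k.
elim/ltn_ind: k s Ek => k IH s Ek Us deg FE Fs.
have [allE|] := boolP (cycle adj s); first by exists s.
rewrite cycle_cedges // -has_predC => /hasP[e0 e0s e0N0].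
have e0N : e0 \notin edges adj := e0N0.
have [t [e1 [g1 [g2 [tP [e1s e1F] g1E g2E eP]]]]] :=
  two_opt_step adjC adjI Us deg e0s e0N.
have ct : (count (fun e => e \notin edges adj) (cedges t) < k)%N.
  have := permP eP (fun e => e \notin edges adj).
  by rewrite /= g1E g2E e0N Ek; lia.
have [|x|//|e eF|u [uP uC uF]] := IH _ ct t erefl.
- by rewrite (perm_uniq tP).
- by rewrite (perm_mem tP) (perm_size tP) (permP tP); apply: deg.
- have := perm_mem eP e; rewrite !inE (Fs _ eF) !orbT.
  by case: eqP => [E|_]; [move: e0N; rewrite -E FE | case: eqP => // E; rewrite -E eF in e1F].
by exists u; split=> //; apply: perm_trans uP tP.
Qed.

(** * Disjoint switches *)

Definition cycle_sum (V : finType) (f : {set V} -> int) (s : seq V) : int :=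
  \sum_(e <- cedges s) f e.

Definition gain (V : finType) (f : {set V} -> int) (v x y : V) : int :=
  f [set v; x] + f [set v; y] - f [set x; y].

(** An insertion destroys only the edge it uses, so distinct target edges all remain available and
    the gains add up. *)
Lemma insert_vertices (V : finType) (adj : rel V) (f : {set V} -> int)
    (M : seq (V * (V * V))) s :
  symmetric adj -> irreflexive adj -> cycle adj s ->
  (forall q, q \in M -> adj q.1 q.2.1 && adj q.1 q.2.2) ->
  (forall q, q \in M -> [set q.2.1; q.2.2] \in cedges s) ->
  uniq [seq [set q.2.1; q.2.2] | q <- M] ->
  exists t, [/\ perm_eq t ([seq q.1 | q <- M] ++ s), cycle adj t &
    cycle_sum f t = cycle_sum f s + \sum_(q <- M) gain f q.1 q.2.1 q.2.2].
Proof.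
move=> adjC adjI; elim: M s => [|[v [x y]] M IH] s cs adjM inM.
  by exists s; rewrite big_nil addr0.
rewrite map_cons cons_uniq /= => /andP[xyN UM].
have [t [tP eP]] := insert_edge v (inM _ (mem_head _ _)).
have /andP[/= vx vy] := adjM _ (mem_head _ _).
have [||q qM|//|u [uP uC uS]] := IH t.
- rewrite cycle_cedges //; move: cs; rewrite cycle_cedges // => /allP cs.
  apply/allP => e et; have := perm_mem eP e; rewrite !inE et orbT.
  by move=> /esym/or3P[/eqP->|/eqP->|/cs]; rewrite ?edgesP.
- by move=> q qM; apply: adjM; rewrite inE qM orbT.
- have := perm_mem eP [set q.2.1; q.2.2].
  rewrite !inE (inM q) ?orbT ?inE ?qM ?orbT // => /orP[/eqP E|//].
  by case/negP: xyN; rewrite -E; apply: (map_f (fun q => [set q.2.1; q.2.2])).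
exists u; split=> //.
  by rewrite (perm_trans uP) // perm_sym -cat1s perm_catCA perm_cat2l /= perm_sym.
have := perm_big _ eP (op := +%R) (x := 0) (P := xpredT) (F := f).
rewrite !big_cons uS /cycle_sum /gain /= => H.
by apply: (addrI (f [set x; y])); rewrite addrA H; ring.
Qed.

Definition switch (V : finType) : Type := (V * seq V * (V * V) * (V * V))%type.

Definition seq_edges (V : finType) (s : seq V) : seq {set V} :=
  if s is x :: p then pedges x p else [::].

Definition pair_edge (V : finType) (p : V * V) : {set V} := [set p.1; p.2].

(* [(v, s, hi, lo)]: the edges [hi] and [lo] both lie on the path [s] inside
   the neighbourhood of [v], and inserting [v] into [hi] adds more to the label
   sum than inserting it into [lo]. *)
Definition is_switch (V : finType) (adj : rel V) (f : {set V} -> int)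
    (q : switch V) : bool :=
  let: (v, s, hi, lo) := q in
  [&& adj v hi.1 && adj v hi.2, adj v lo.1 && adj v lo.2,
      (pair_edge hi \in edges adj) && (pair_edge lo \in edges adj),
      (pair_edge hi \in seq_edges s) && (pair_edge lo \in seq_edges s)
    & gain f v lo.1 lo.2 < gain f v hi.1 hi.2].

Lemma seq_edges_cycle (V : finType) (s1 s2 s3 : seq V) :
  {subset seq_edges s2 <= cedges (s1 ++ s2 ++ s3)}.
Proof.
move=> e; case: s2 => //= x p ep.
rewrite (perm_mem (cedges_catC s1 _)) /= -cats1 -!catA pedges_cat.
by rewrite mem_cat ep.
Qed.

Lemma mem_seq_edges (V : finType) (s : seq V) (u : V) e :
  e \in seq_edges s -> u \in e -> u \in s.
Proof. by case: s => //= x p; apply: mem_pedges. Qed.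

Lemma disjoint_edges_uniq (V : finType) (I : eqType) (s : I -> seq V)
    (g : I -> V * V) (L : seq I) :
  uniq (flatten [seq s i | i <- L]) ->
  (forall i, i \in L -> pair_edge (g i) \in seq_edges (s i)) ->
  uniq [seq pair_edge (g i) | i <- L].
Proof.
elim: L => //= i L IH; rewrite cat_uniq => /and3P[_ /hasPn dis UL] gs.
rewrite IH // ?andbT => [|j jL]; last by apply: gs; rewrite inE jL orbT.
apply/negP => /mapP[j jL E].
have gi : (g i).1 \in s i.
  by apply: mem_seq_edges (gs i (mem_head _ _)) _; rewrite set21.
have /dis : (g i).1 \in flatten [seq s k | k <- L]; last by rewrite gi.
apply/flattenP; exists (s j); first exact: map_f.
apply: mem_seq_edges (gs j _) _; first by rewrite inE jL orbT.
by rewrite -E set21.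
Qed.

Lemma degree_count (V : finType) (adj : rel V) x :
  degree adj x = count (adj x) (enum V).
Proof. by rewrite /degree cardsE cardE enumT -size_filter. Qed.

(** Lay the paths of the switches one after another, followed by all other vertices except the
    centres. Posa's theorem makes this a cycle keeping every [hi] and [lo] edge; the centres then go
    into the [hi] edges for [t1] and into the [lo] edges for [t2], and each switch contributes at
    least 1 to the difference. *)
Lemma switch_cycles (V : finType) (adj : rel V) (f : {set V} -> int)
    (L : seq (switch V)) :
  symmetric adj -> irreflexive adj -> all (is_switch adj f) L ->
  uniq (flatten [seq q.1.1.1 :: q.1.1.2 | q <- L]) ->
  (forall x, #|V| + 3 * size L <= 2 * degree adj x)%N ->
  exists t1 t2,
    [/\ perm_eq t1 (enum V) && perm_eq t2 (enum V), cycle adj t1, cycle adj t2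
      & cycle_sum f t2 + (size L)%:Z <= cycle_sum f t1].
Proof.
move=> adjC adjI /allP swL UL deg.
pose ctr := [seq q.1.1.1 | q <- L]; pose seg := flatten [seq q.1.1.2 | q <- L].
have flatP : perm_eq (flatten [seq q.1.1.1 :: q.1.1.2 | q <- L]) (ctr ++ seg).
  rewrite /ctr /seg; elim: (L) => //= q M IH; rewrite perm_cons perm_sym.
  by rewrite perm_catCA perm_cat2l perm_sym.
have {UL} U : uniq (ctr ++ seg) by rewrite -(perm_uniq flatP).
pose rest := [seq x <- enum V | x \notin ctr ++ seg].
have sP : perm_eq (ctr ++ (seg ++ rest)) (enum V).
  rewrite catA; apply: uniq_perm; rewrite ?enum_uniq //.
    rewrite cat_uniq U filter_uniq ?enum_uniq // andbT.
    by apply/hasPn => x; rewrite mem_filter => /andP[].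
  move=> x; rewrite mem_cat mem_filter mem_enum andbT.
  by rewrite orbN.
pose hi (q : switch V) := q.1.2; pose lo (q : switch V) := q.2.
pose F := [seq pair_edge (hi q) | q <- L] ++ [seq pair_edge (lo q) | q <- L].
have szF : size F = (2 * size L)%N by rewrite size_cat !size_map; lia.
have FE : {subset F <= edges adj}.
  move=> e; rewrite mem_cat.
  by case/orP=> /mapP[[[[v s] h] l] /swL/and5P[_ _ /andP[? ?] _ _] ->].
have hiP q : q \in L -> pair_edge (hi q) \in seq_edges q.1.1.2.
  by case: q => [[[v s] h] l] /swL/and5P[_ _ _ /andP[? ?] _].
have loP q : q \in L -> pair_edge (lo q) \in seq_edges q.1.1.2.
  by case: q => [[[v s] h] l] /swL/and5P[_ _ _ /andP[? ?] _].
have seg_sub q : q \in L -> {subset seq_edges q.1.1.2 <= cedges (seg ++ rest)}.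
  move=> qL; rewrite /seg; case/path.splitPr: qL => L1 L2.
  rewrite map_cat flatten_cat /= -!catA; exact: seq_edges_cycle.
have Fs : {subset F <= cedges (seg ++ rest)}.
  move=> e; rewrite mem_cat => /orP[] /mapP[q qL ->]; apply: (seg_sub q) => //.
    exact: hiP.
  exact: loP.
have Us : uniq (seg ++ rest).
  by move: (perm_uniq sP); rewrite enum_uniq cat_uniq => /and3P[].
have [x _|t [tP tC tF]] := @posa_cycle V adj F _ adjC adjI Us _ FE Fs.
  (* With [k] centres removed and [2 * k] edges prescribed, the requirement is
     [n - k + 2 * k <= 2 * (delta - k)]. This is the source of [3 * size L]. *)
  have arith k N n i j : (i <= k -> k + N = n -> n + 3 * k <= 2 * (i + j) ->
    N + 2 * k <= 2 * j)%N by lia.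
  have szctr : size ctr = size L by rewrite size_map.
  rewrite szF -szctr; apply: (arith _ _ #|V| (count (adj x) ctr)).
  - exact: count_size.
  - by rewrite cardE -(perm_size sP) [RHS]size_cat.
  - by rewrite -count_cat (permP sP) -degree_count szctr; apply: deg.
have Useg : uniq seg by move: U; rewrite cat_uniq => /and3P[].
have ins (g : switch V -> V * V) :
    (forall q, q \in L -> adj q.1.1.1 (g q).1 && adj q.1.1.1 (g q).2) ->
    (forall q, q \in L -> pair_edge (g q) \in seq_edges q.1.1.2) ->
    (forall q, q \in L -> pair_edge (g q) \in F) ->
    exists t', [/\ perm_eq t' (enum V), cycle adj t' &
      cycle_sum f t' =
      cycle_sum f t + \sum_(q <- L) gain f q.1.1.1 (g q).1 (g q).2].
  move=> adjg gs gF.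
  have [|_ /mapP[q qL ->]|_ /mapP[q qL ->]||t' [t'P t'C t'S]] :=
    @insert_vertices V adj f [seq (q.1.1.1, g q) | q <- L] t adjC adjI.
  - by [].
  - exact: adjg.
  - exact/tF/gF.
  - by rewrite -map_comp; apply: (disjoint_edges_uniq Useg gs).
  exists t'; split=> //; last by rewrite t'S big_map.
  rewrite (perm_trans t'P) // -map_comp (perm_trans _ sP) //.
  by rewrite perm_cat2l.
have [||q qL|t1 [t1P t1C t1S]] := ins hi.
- by case=> [[[v s] h] l] /swL/and5P[].
- exact: hiP.
- by rewrite mem_cat (map_f (fun q => pair_edge (hi q))).
have [||q qL|t2 [t2P t2C t2S]] := ins lo.
- by case=> [[[v s] h] l] /swL/and5P[].
- exact: loP.
- by rewrite mem_cat (map_f (fun q => pair_edge (lo q))) ?orbT.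
exists t1, t2; split; rewrite ?t1P ?t2P // t1S t2S -addrA lerD2l.
have -> : (size L)%:Z = \sum_(q <- L) 1.
  by rewrite big_const_seq count_predT iter_addr_0 -mulr_natr mul1r natz.
rewrite -big_split /= !big_seq; apply: ler_sum => q qL.
by case: q qL => [[[v s] h] l] /swL/and5P[_ _ _ _]; rewrite /hi /lo /=; lia.
Qed.

(** * Rigid labellings *)

(** Two edges with a common end give a path on three vertices. Disjoint ones are joined by the pair
    [yz], which may be a nonedge: only the two given edges have to survive in Posa's theorem. *)
Lemma two_edge_path (V : finType) (x y z t : V) :
  x != y -> z != t -> [set x; y] != [set z; t] ->
  exists s, [/\ uniq s, (size s <= 4)%N, {subset s <= [:: x; y; z; t]},
     [set x; y] \in seq_edges s & [set z; t] \in seq_edges s].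
Proof.
move=> xy zt E.
have [xz|xz] := eqVneq x z; first subst z.
  have yt : y != t by apply: contraNneq E => ->.
  exists [:: y; x; t]; split=> //=; rewrite ?inE ?(eq_sym y x) ?negb_or ?xy ?yt ?zt //.
  - by move=> u; rewrite !inE => /or3P[]->; rewrite ?orbT.
  - by rewrite (set2C y) eqxx.
  - by rewrite eqxx orbT.
have [xt|xt] := eqVneq x t; first subst t.
  have yz : y != z by apply: contraNneq E => ->; rewrite set2C.
  exists [:: y; x; z]; split=> //=; rewrite ?inE ?(eq_sym y x) ?negb_or ?xy ?yz ?xz //.
  - by move=> u; rewrite !inE => /or3P[]->; rewrite ?orbT.
  - by rewrite (set2C y) eqxx.
  - by rewrite (set2C x z) eqxx orbT.
have [yz|yz] := eqVneq y z; first subst z.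
  exists [:: x; y; t]; split=> //=; rewrite ?inE ?negb_or ?xy ?xt ?zt //.
  - by move=> u; rewrite !inE => /or3P[]->; rewrite ?orbT.
  - by rewrite eqxx.
  - by rewrite eqxx orbT.
have [yt|yt] := eqVneq y t; first subst t.
  exists [:: x; y; z]; split=> //=; rewrite ?inE ?negb_or ?xy ?xz ?yz //.
  - by move=> u; rewrite !inE => /or3P[]->; rewrite ?orbT.
  - by rewrite eqxx.
  - by rewrite (set2C y z) eqxx orbT.
exists [:: x; y; z; t]; split=> //=; rewrite ?inE ?negb_or ?xy ?xz ?yz ?xt ?yt ?zt //.
- by rewrite eqxx.
- by rewrite eqxx !orbT.
Qed.

Lemma gain_edge (V : finType) (f : {set V} -> int) (v x y z t : V) :
  [set x; y] = [set z; t] -> gain f v x y = gain f v z t.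
Proof.
by move=> E; rewrite /gain E; case/set2_inj: E => -[-> ->] //; congr (_ - _); rewrite addrC.
Qed.

Definition rigid (V : finType) (adj : rel V) (f : {set V} -> int)
    (X : {set V}) : Prop :=
  forall v x y z t, all [predC X] [:: v; x; y; z; t] ->
    adj v x && adj v y && adj x y -> adj v z && adj v t && adj z t ->
  gain f v x y = gain f v z t.

Lemma rigid_or_switch (V : finType) (adj : rel V) (f : {set V} -> int)
    (X : {set V}) : symmetric adj -> irreflexive adj ->
  rigid adj f X \/
  exists q : switch V, [/\ is_switch adj f q, uniq (q.1.1.1 :: q.1.1.2),
    (size q.1.1.2 <= 4)%N & all [predC X] (q.1.1.1 :: q.1.1.2)].
Proof.
move=> adjC adjI.
have mk v x y z t : all [predC X] [:: v; x; y; z; t] ->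
    adj v x && adj v y && adj x y -> adj v z && adj v t && adj z t ->
    gain f v z t < gain f v x y ->
    exists q : switch V, [/\ is_switch adj f q, uniq (q.1.1.1 :: q.1.1.2),
      (size q.1.1.2 <= 4)%N & all [predC X] (q.1.1.1 :: q.1.1.2)].
  move=> XN /andP[/andP[vx vy] xy] /andP[/andP[vz vt] zt] lt.
  have nxy : x != y by apply: contraTneq xy => ->; rewrite adjI.
  have nzt : z != t by apply: contraTneq zt => ->; rewrite adjI.
  have nE : [set x; y] != [set z; t].
    by apply: contraTneq lt => /gain_edge->; rewrite ltxx.
  have [s [Us ss sub xys zts]] := two_edge_path nxy nzt nE.
  exists (v, s, (x, y), (z, t)); split=> //.
  - by rewrite /is_switch /pair_edge /= vx vy vz vt !edgesP // xy zt xys zts lt.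
  - rewrite /= Us andbT; apply/negP => /sub; rewrite !inE.
    by case/or4P => /eqP E; [move: vx|move: vy|move: vz|move: vt]; rewrite E adjI.
  - apply/allP => u uv; apply: (allP XN); move: uv; rewrite !inE.
    by move=> /predU1P[->|/sub]; rewrite ?eqxx // !inE => ->; rewrite orbT.
pose viol (q : V * V * V * V * V) := let: (v, x, y, z, t) := q in
  [&& all [predC X] [:: v; x; y; z; t], adj v x && adj v y && adj x y,
      adj v z && adj v t && adj z t & gain f v x y != gain f v z t].
have [/existsP[[[[[v x] y] z] t] /and4P[XN a1 a2]]|no] := boolP [exists q, viol q].
  rewrite neq_lt => /orP[lt|]; last by move=> lt; right; apply: mk lt.
  right; apply: mk lt => //.
  by move: XN => /and5P[vX xX yX zX /andP[tX _]]; apply/and5P; split=> //; rewrite andbT.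
left=> v x y z t XN a1 a2; apply/eqP; apply: contraNT no => ne.
by apply/existsP; exists (v, x, y, z, t); rewrite /viol XN a1 a2 ne.
Qed.

(** Greedy choice: a switch occupies at most five vertices, its centre and a path on at most four.
    If no switch avoids those already chosen, their vertices form [X]. *)
Lemma switches_or_rigid (V : finType) (adj : rel V) (f : {set V} -> int) k :
  symmetric adj -> irreflexive adj ->
  (exists L : seq (switch V), [/\ size L = k.+1, all (is_switch adj f) L
     & uniq (flatten [seq q.1.1.1 :: q.1.1.2 | q <- L])]) \/
  (exists2 X : {set V}, (#|X| <= 5 * k)%N & rigid adj f X).
Proof.
move=> adjC adjI.
suff [[L [szL swL UL _]]|[j [X [jk]]]] :
    (exists L : seq (switch V), [/\ size L = k.+1, all (is_switch adj f) L,
      uniq (flatten [seq q.1.1.1 :: q.1.1.2 | q <- L])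
      & (size (flatten [seq q.1.1.1 :: q.1.1.2 | q <- L]) <= 5 * k.+1)%N]) \/
    (exists j (X : {set V}), [/\ (j < k.+1)%N, (#|X| <= 5 * j)%N & rigid adj f X]).
- by left; exists L.
- by move=> cX rX; right; exists X => //; lia.
elim: k.+1 => [|j IH]; first by left; exists [::].
case: IH => [[L [szL swL UL cL]]|[i [X [ij cX rX]]]]; last first.
  by right; exists i, X; split=> //; lia.
set U := flatten _ in UL cL.
have [rX|[q [swq Uq sq qN]]] := @rigid_or_switch V adj f [set x in U] adjC adjI.
  right; exists j, [set x in U]; split=> //.
  by rewrite cardsE (leq_trans (card_size _)).
left; exists (q :: L); split.
- by rewrite /= szL.
- by apply/andP.
- rewrite map_cons [flatten _]/= -/U -cat_cons cat_uniq Uq UL andbT.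
  apply/hasPn => x xU; apply/negP => /(allP qN); by rewrite !inE xU.
- by rewrite map_cons [flatten _]/= -/U /= size_cat; lia.
Qed.

(** The constant gain [g] is a potential for [f]. A balanced vertex has edges of both labels leading
    outside [X], which excludes [g = 3] and [g = -3] there; a common neighbour then forces equal
    values at any two balanced vertices. *)
Lemma rigid_label (V : finType) (adj : rel V) (f : {set V} -> int)
    (X B : {set V}) :
  symmetric adj -> irreflexive adj -> edge_labelling adj f -> rigid adj f X ->
  (forall x y, x \notin X -> y \notin X ->
     exists2 z, z \notin X & adj x z && adj y z) ->
  (forall v a, v \in B -> v \notin X -> a = 1 \/ a = -1 ->
     exists2 u, u \notin X & adj v u /\ f [set v; u] = a) ->
  exists2 a, a = 1 \/ a = -1 &
    forall u v, u \in B :\: X -> v \in B :\: X -> adj u v -> f [set u; v] = a.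
Proof.
move=> adjC adjI lab rig common bal.
have labP x y : adj x y -> f [set x; y] = -1 \/ f [set x; y] = 1.
  by move=> xy; apply: lab; rewrite edgesP.
pose tri v (p : V * V) := [&& p.1 \notin X, p.2 \notin X &
  adj v p.1 && adj v p.2 && adj p.1 p.2].
(* The default [0] is for vertices in no triangle outside [X]; by [common], every vertex outside [X]
   lies in one. *)
pose g v := if [pick p | tri v p] is Some p then gain f v p.1 p.2 else 0.
have gE v x y : v \notin X -> x \notin X -> y \notin X ->
    adj v x -> adj v y -> adj x y -> gain f v x y = g v.
  move=> vX xX yX vx vy xy; rewrite /g; case: pickP => [[z t] /and3P[/= zX tX a]|/(_ (x, y))].
    by apply: rig; rewrite //= ?inE ?vX ?xX ?yX ?zX ?tX ?vx ?vy.
  by rewrite /tri /= xX yX vx vy xy.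
(* [f] is given by a potential: [f xy = (g x + g y) / 2]. *)
have pot u v : u \notin X -> v \notin X -> adj u v ->
    2 * f [set u; v] = g u + g v.
  move=> uX vX uv; have [z zX /andP[uz vz]] := common u v uX vX.
  rewrite -(gE u v z) // -(gE v u z) ?(adjC v u) // /gain (set2C v u).
  (* In the triangle [uvz] the gains at [u] and [v] add up to [2 * f [set u; v]], the other two
     labels cancelling. *)
  by rewrite -(set2C z v) -(set2C z u); lia.
have g_val v : v \notin X -> [\/ g v = 1, g v = -1, g v = 3 | g v = -3].
  move=> vX; have [u uX /andP[vu _]] := common v v vX vX.
  have [z zX /andP[vz uz]] := common v u vX uX.
  rewrite -(gE v u z) // /gain.
  case: (labP _ _ vu) (labP _ _ vz) (labP _ _ uz) => -> [] -> [] ->;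
    first [by apply: Or41|by apply: Or42|by apply: Or43|by apply: Or44].
have gB v : v \in B -> v \notin X -> g v = 1 \/ g v = -1.
  move=> vB vX.
  have [u uX [vu fu]] := bal v 1 vB vX (or_introl erefl).
  have [w wX [vw fw]] := bal v (-1) vB vX (or_intror erefl).
  have := pot v u vX uX vu; have := pot v w vX wX vw; rewrite fu fw.
  by case: (g_val v vX) (g_val u uX) (g_val w wX) => -> [] -> [] ->; lia.
have same u v : u \in B :\: X -> v \in B :\: X -> g u = g v.
  rewrite !inE => /andP[uX uB] /andP[vX vB].
  have [z zX /andP[uz vz]] := common u v uX vX.
  have := pot u z uX zX uz; have := pot v z vX zX vz.
  by case: (gB u uB uX) (gB v vB vX) (labP _ _ uz) (labP _ _ vz) => -> [] -> [] -> [] ->; lia.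
have [E|[w wBX]] := set_0Vmem (B :\: X).
  by exists 1; [left|move=> u v; rewrite E inE].
exists (g w) => [|u v uBX vBX uv].
  by move: wBX; rewrite inE => /andP[wX wB]; apply: gB.
have uX : u \notin X by case/setDP: uBX.
have vX : v \notin X by case/setDP: vBX.
by have := pot u v uX vX uv; rewrite (same u w) // (same v w) //; lia.
Qed.

(** At least [2 * #|B| - #|V|] edges of the cycle lie inside [B] and have label [a]; every other
    edge costs at most 1. Here the fraction 3/4 arises. *)
Lemma label_cycle_sum (V : finType) (adj : rel V) (f : {set V} -> int)
    (B : {set V}) (a : int) s :
  symmetric adj -> irreflexive adj -> edge_labelling adj f ->
  a = 1 \/ a = -1 ->
  (forall u v, u \in B -> v \in B -> adj u v -> f [set u; v] = a) ->
  perm_eq s (enum V) -> cycle adj s ->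
  (4 * #|B|)%:Z - (3 * #|V|)%:Z <= `|cycle_sum f s|.
Proof.
move=> adjC adjI lab aP Ba sP; rewrite cycle_cedges // => /allP sE.
have labB e : e \in edges adj -> e \subset B -> f e = a.
  move=> /imsetP[[x y]]; rewrite inE /= => xy ->.
  by rewrite subUset !sub1set => /andP[xB yB]; apply: Ba.
have sum_ge (l : seq {set V}) : {subset l <= edges adj} ->
    (2 * count (fun e : {set V} => e \subset B) l)%:Z - (size l)%:Z <=
    a * \sum_(e <- l) f e.
  elim: l => [|e l IH] lE; first by rewrite big_nil mulr0.
  rewrite big_cons mulrDr /=.
  have {IH} := IH (fun x xl => lE x (mem_behead (s := e :: l) xl)).
  have eE := lE e (mem_head _ _).
  have := labB e eE; have := lab e eE.
  set S := \sum_(_ <- _) _; set c := count _ _; set m := size _.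
  case: (e \subset B) => /= [_ /(_ isT) ->|fe _]; last first.
    by case: aP fe => -> [] ->; lia.
  by case: aP => ->; lia.
have := sum_ge _ sE; rewrite size_cedges -/(cycle_sum f s).
have := count_cedges B s; rewrite (perm_size sP) -cardE.
have -> : count (mem B) s = #|B|.
  by rewrite (permP sP) cardE enumT -size_filter.
have arith (b c n : nat) (x : int) : (2 * b <= n + c)%N ->
    (2 * c)%:Z - n%:Z <= a * x -> (4 * b)%:Z - (3 * n)%:Z <= `|x|.
  by case: aP => ->; lia.
exact: arith.
Qed.

(** * Labellings with constant sum on Hamilton cycles *)

(** The first exchange brings in [e] together with [g0], which may be a nonedge. A second exchange
    that protects [e] then removes [g0] at the price of one more edge [r3]. *)
Lemma two_opt_repair (V : finType) (adj : rel V) s t1 (e g0 r1 r2 : {set V}) :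
  symmetric adj -> irreflexive adj -> uniq s ->
  (forall u, u \in s -> size s + 1 <= 2 * count (adj u) s)%N ->
  cycle adj s -> e \in edges adj -> e \notin cedges s -> perm_eq t1 s ->
  r1 \in cedges s -> r2 \in cedges s ->
  perm_eq (r1 :: r2 :: cedges t1) (e :: g0 :: cedges s) ->
  exists t r3, [/\ perm_eq t s, cycle adj t, e \in cedges t &
    forall g, g \in cedges s -> g \notin [:: r1; r2; r3] -> g \in cedges t].
Proof.
have arith (i j k : nat) : (i + (j + k) = i -> k = 0)%N by lia.
move=> adjC adjI Us deg; rewrite cycle_cedges // => /allP sE eE es t1P r1s r2s P1.
have e1 : e \in cedges t1.
  have := perm_mem P1 e; rewrite !inE eqxx /=.
  case: eqP => [E|_]; first by rewrite E r1s in es.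
  by case: eqP => [E|_] //; rewrite E r2s in es.
have keep1 g : g \in cedges s -> g \notin [:: r1; r2] -> g \in cedges t1.
  move=> gs; have := perm_mem P1 g; rewrite !inE gs !orbT.
  by case: (g == r1) => //; case: (g == r2).
pose nonedge (g : {set V}) := g \notin edges adj.
have no_s : count nonedge (cedges s) = 0%N.
  by apply/eqP; rewrite -leqn0 leqNgt -has_count; apply/hasPn => g /sE; rewrite /nonedge negbK.
have hamP t : count nonedge (cedges t) = 0%N -> cycle adj t.
  move=> c0; rewrite cycle_cedges //; apply/allP => g gt.
  apply: contraT => gN; have : has nonedge (cedges t) by apply/hasP; exists g.
  by rewrite has_count c0.
have nE g : g \in edges adj -> nonedge g = false by rewrite /nonedge => ->.
have := permP P1 nonedge.
rewrite /= no_s (nE r1 (sE _ r1s)) (nE r2 (sE _ r2s)) (nE e eE) !add0n addn0 => c1.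
have [g0E|g0N] := boolP (g0 \in edges adj).
  exists t1, r1; split=> //.
    by apply: hamP; rewrite c1 nE.
  move=> g gs gN; apply: keep1 => //.
  by move: gN; rewrite !inE !negb_or => /and3P[-> ->].
have g01 : g0 \in cedges t1.
  have := perm_mem P1 g0; rewrite !inE eqxx orbT.
  case: eqP => [E|_]; first by rewrite E sE in g0N.
  by case: eqP => [E|_] //; rewrite E sE in g0N.
have [||t [e2 [h1 [h2 [tP [e2t e2F] h1E h2E P2]]]]] :=
  @two_opt_step V adj [:: e] t1 g0 adjC adjI _ _ g01 g0N.
- by rewrite (perm_uniq t1P).
- by move=> u; rewrite (perm_mem t1P) (perm_size t1P) (permP t1P); apply: deg.
have keep2 g : g \in cedges t1 -> g \in edges adj -> g != e2 -> g \in cedges t.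
  move=> gt gE ge2; have := perm_mem P2 g; rewrite !inE gt !orbT (negPf ge2) /=.
  by case: eqP => // E; rewrite -E gE in g0N.
exists t, e2; split.
- exact: perm_trans tP t1P.
- apply: hamP; have := permP P2 nonedge.
  rewrite /= (nE h1 h1E) (nE h2 h2E) c1 !add0n; exact: arith.
- by apply: keep2 => //; move: e2F; rewrite inE eq_sym.
move=> g gs gN; apply: keep2; last by move: gN; rewrite !inE !negb_or => /and3P[].
  by apply: keep1 => //; move: gN; rewrite !inE !negb_or => /and3P[-> ->].
exact: sE.
Qed.

(* Adding the chord [xy] by a 2-opt move is possible in two ways, which remove
   disjoint pairs of edges of [s].  As one more edge is removed for repair,
   some edge of [s] in [D] survives one of the two ways. *)
Lemma chord_cycle (V : finType) (adj : rel V) (D : pred {set V}) s x y :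
  symmetric adj -> irreflexive adj -> uniq s ->
  (forall u, u \in s -> size s + 1 <= 2 * count (adj u) s)%N ->
  cycle adj s -> (3 <= count D (cedges s))%N ->
  x \in s -> y \in s -> adj x y -> D [set x; y] ->
  exists t g, [/\ perm_eq t s, cycle adj t, [set x; y] \in cedges t,
    g \in cedges s & D g /\ g \in cedges t].
Proof.
move=> adjC adjI Us deg cs cD xs ys xy Dxy.
have [es|es] := boolP ([set x; y] \in cedges s); first by exists s, [set x; y].
have exy : [set x; y] \in edges adj by rewrite edgesP.
have [p [p1 [p2 [sP eP Ep]]]] : exists p p1 p2, [/\ perm_eq (x :: p) s,
    perm_eq (cedges (x :: p)) (cedges s) & p = p1 ++ y :: p2].
  have [i p Ep] := rot_to xs.
  have xpP : perm_eq (x :: p) s by rewrite -Ep perm_rot.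
  have : y \in x :: p by rewrite (perm_mem xpP).
  rewrite inE => /predU1P[yx|]; first by move: xy; rewrite yx adjI.
  move=> yp; have [p1 [p2 E]] : exists p1 p2, p = p1 ++ y :: p2.
    by case/path.splitPr: yp => p1 p2; exists p1, p2.
  exists p, p1, p2; split=> //.
  by rewrite -Ep -[X in perm_eq _ (cedges X)](cat_take_drop i) cedges_catC.
have UP : uniq (x :: p) by rewrite (perm_uniq sP).
case: p1 Ep => [|c p1] Ep.
  by move: es; rewrite -(perm_mem eP) Ep /= mem_head.
case: p2 Ep => [|d p2] Ep.
  move: es; rewrite -(perm_mem eP) Ep -cat_cons.
  have -> : [set x; y] = [set last y [::]; x] by rewrite set2C.
  by rewrite cedges_cat !(mem_cat, inE) eqxx !orbT.
subst p.
have UE : uniq (cedges s).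
  by rewrite -(perm_uniq eP) cedges_uniq //= size_cat /= addnS.
(* One move drops the edges leaving [x] and [y] along the cycle, the other the edges entering
   them. *)
set r1 := [set y; d]; set r2 := [set x; c].
set q1 := [set last c p1; y]; set q2 := [set last d p2; x].
have mem_r g : g \in [:: r1; r2; q1; q2] -> g \in cedges s.
  rewrite -(perm_mem eP) -[x :: _]/((x :: c :: p1) ++ (y :: d :: p2)) cedges_cat.
  by rewrite /= !(mem_cat, inE) => /or4P[]->; rewrite ?orbT.
have Ur : uniq [:: r1; r2; q1; q2].
  move: UP; rewrite -[x :: _]/((x :: c :: p1) ++ (y :: d :: p2)) cat_uniq.
  rewrite [uniq (x :: _)]/= [uniq (y :: _)]/= => /and3P[/andP[xN _] /hasPn dis /andP[yN _]].
  have xp2 : x \notin y :: d :: p2.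
    by apply/negP => /dis; rewrite mem_head.
  have yp1 : y \notin c :: p1.
    by apply: contra (dis y (mem_head _ _)) => h; rewrite inE h orbT.
  have nyx : y != x by apply: contraNneq xp2 => ->; rewrite mem_head.
  have cd u w : u \in c :: p1 -> w \in d :: p2 -> u != w.
    move=> u1 w2; apply: contraTneq w2 => <-; apply/negP => u2.
    by have := dis u; rewrite !inE in u1 u2 *; rewrite u1 u2 !orbT => /(_ isT).
  have cp : c \in c :: p1 := mem_head _ _.
  have lp : last c p1 \in c :: p1 := mem_last _ _.
  have dp : d \in d :: p2 := mem_head _ _.
  have mp : last d p2 \in d :: p2 := mem_last _ _.
  have xr1 : x \notin r1.
    by move: xp2; rewrite !inE !negb_or => /and3P[-> ->].
  have xq1 : x \notin q1.
    rewrite !inE negb_or (eq_sym x y) nyx andbT.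
    by apply: contraNneq xN => ->.
  have xr2 : x \in r2 by rewrite set21.
  have xq2 : x \in q2 by rewrite set22.
  have d1 : r1 != r2 by apply: contraNneq xr1 => ->.
  have d2 : r1 != q2 by apply: contraNneq xr1 => ->.
  have d3 : r2 != q1 by apply: contraNneq xq1 => <-.
  have d4 : q1 != q2 by apply: contraNneq xq1 => ->.
  have d5 : r1 != q1.
    apply/eqP => /set2_inj[[E _]|[_ E]].
      by move: yp1; rewrite E lp.
    by move: (cd _ _ lp dp); rewrite E eqxx.
  have d6 : r2 != q2.
    apply/eqP => /set2_inj[[E _]|[_ E]].
      by move: xp2; rewrite E inE mp orbT.
    by move: (cd _ _ cp mp); rewrite E eqxx.
  by rewrite /= !inE !negb_or d1 d2 d3 d4 d5 d6.
have [||||t [r3 [tP tC te tK]]] := two_opt_repair (e := [set x; y]) (r1 := r1) (r2 := r2)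
  (t1 := rev (c :: rcons p1 y) ++ d :: rcons p2 x) (g0 := [set c; d])
  adjC adjI Us deg cs exy es.
- apply: (@perm_trans _ ((c :: rcons p1 y) ++ d :: rcons p2 x)).
    by rewrite perm_cat2r perm_rev.
  apply: perm_trans sP; rewrite -!cats1 -!cat_cons -!catA /=.
  rewrite -[_ :: _ ++ _]/((c :: p1) ++ [:: y, d & p2 ++ [:: x]]).
  by rewrite -[[:: y, d & _ ++ _]]/([:: y, d & p2] ++ [:: x]) catA perm_catC.
- by apply: mem_r; rewrite !inE eqxx.
- by apply: mem_r; rewrite !inE eqxx orbT.
- have := two_opt c d (rcons p1 y) (rcons p2 x); rewrite !last_rcons => P.
  apply: perm_trans P _; apply/permP => Q /=.
  have := permP eP Q.
  have := permP (cedges_catC [:: x] ((c :: p1) ++ (y :: d :: p2))) Q.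
  rewrite (_ : (_ ++ _) ++ [:: x] = (c :: rcons p1 y) ++ d :: rcons p2 x); last first.
    by rewrite -!cats1 /= -!catA.
  by move=> /= -> ->; rewrite addnCA.
have [||||u [q3 [uP uC ue uK]]] := two_opt_repair (e := [set x; y]) (r1 := q1) (r2 := q2)
  (t1 := rev (x :: c :: p1) ++ y :: d :: p2) (g0 := [set last d p2; last c p1])
  adjC adjI Us deg cs exy es.
- by apply: perm_trans sP; rewrite -!cat_cons perm_cat2r perm_rev.
- by apply: mem_r; rewrite !inE eqxx !orbT.
- by apply: mem_r; rewrite !inE eqxx !orbT.
- apply: perm_trans (two_opt x y (c :: p1) (d :: p2)) _.
  by rewrite !perm_cons; exact: eP.
pose Ds := [seq g <- cedges s | D g].
have UD : uniq Ds by rewrite filter_uniq.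
have cDs : (3 <= size Ds)%N by rewrite size_filter.
have [/hasP[g gD gN]|/hasPn no1] := boolP (has (fun g => g \notin [:: r1; r2; r3]) Ds).
  move: gD; rewrite mem_filter => /andP[Dg gs].
  by exists t, g; split=> //; split=> //; apply: tK.
have [/hasP[g gD gN]|/hasPn no2] := boolP (has (fun g => g \notin [:: q1; q2; q3]) Ds).
  move: gD; rewrite mem_filter => /andP[Dg gs].
  by exists u, g; split=> //; split=> //; apply: uK.
have sub1 : {subset Ds <= [:: r1; r2; r3]} by move=> g /no1; rewrite negbK.
have sub2 : {subset Ds <= [:: q1; q2; q3]} by move=> g /no2; rewrite negbK.
(* If neither move keeps an edge in [D], both triples coincide with the set of at least three such
   edges. Then four distinct edges lie in a list of three. *)
have [_ eq1] := uniq_min_size UD sub1 cDs.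
have [_ eq2] := uniq_min_size UD sub2 cDs.
have /(uniq_leq_size Ur) : {subset [:: r1; r2; q1; q2] <= [:: r1; r2; r3]}.
  move=> g; rewrite [g \in [:: r1; r2; q1; q2]]inE => /predU1P[->|]; first by rewrite mem_head.
  rewrite inE => /predU1P[->|]; first by rewrite !inE eqxx orbT.
  move=> gq; apply: sub1; rewrite eq2; move: gq; rewrite !inE.
  by case/orP => ->; rewrite ?orbT.
by [].
Qed.

(** Inserting [v] into an edge of a Hamilton cycle [r] of [G - v] has gain [a - cycle_sum f r],
    whichever edge in the neighbourhood of [v] is used. Two such cycles sharing an edge of this kind
    thus have equal sums, and [chord_cycle] links a fixed cycle to one through any given edge. *)
Lemma constant_sum_rigid (V : finType) (adj : rel V) (f : {set V} -> int) a :
  symmetric adj -> irreflexive adj ->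
  (forall u, #|V| + 2 <= 2 * degree adj u)%N ->
  (forall s, perm_eq s (enum V) -> cycle adj s -> cycle_sum f s = a) ->
  rigid adj f set0.
Proof.
move=> adjC adjI deg sum_a v x y z t _ a1 a2.
pose s0 := [seq u <- enum V | u != v].
have s0P : perm_eq (v :: s0) (enum V).
  apply: uniq_perm; rewrite ?enum_uniq //.
    by rewrite /= mem_filter eqxx filter_uniq // enum_uniq.
  move=> u; rewrite inE mem_filter mem_enum andbT; exact: orbN.
have degs s : perm_eq s s0 -> forall u, (size s + 1 <= 2 * count (adj u) s)%N.
  move=> sP u; rewrite (perm_size sP) (permP sP).
  have := deg u; rewrite degree_count -(permP s0P) cardE -(perm_size s0P) /=.
  by case: (adj u v) => /=; lia.
have Us0 : uniq s0 by rewrite filter_uniq // enum_uniq.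
have [|||s [sP sC _]] := @posa_cycle V adj [::] s0 adjC adjI Us0.
- by move=> u _; have := degs s0 (perm_refl _) u; rewrite /=; lia.
- by [].
- by [].
have gainE r z1 z2 : perm_eq r s0 -> cycle adj r -> [set z1; z2] \in cedges r ->
    adj v z1 -> adj v z2 -> gain f v z1 z2 = a - cycle_sum f r.
  move=> rP rC zr vz1 vz2.
  have [q|q|//|r' [r'P r'C r'S]] := @insert_vertices V adj f [:: (v, (z1, z2))] r adjC adjI rC.
  - by rewrite inE => /eqP-> /=; rewrite vz1 vz2.
  - by rewrite inE => /eqP->.
  rewrite -(sum_a r' _ r'C) ?r'S ?big_seq1 /=; first by ring.
  by apply: perm_trans r'P _; apply: perm_trans s0P; rewrite perm_cons.
suff all_eq z1 z2 : adj v z1 && adj v z2 && adj z1 z2 ->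
    gain f v z1 z2 = a - cycle_sum f s by rewrite !all_eq.
move=> /andP[/andP[vz1 vz2] z12].
pose D := [pred g : {set V} | g \subset [set u | adj v u]].
have in_s u : adj v u -> u \in s.
  move=> vu; rewrite (perm_mem sP) mem_filter mem_enum andbT.
  by apply: contraTneq vu => ->; rewrite adjI.
(* Of the [n - 1] edges of [s], at least [2 * degree adj v - (n - 1)] lie in the neighbourhood of
   [v], which is at least 3. *)
have cD : (3 <= count D (cedges s))%N.
  have := count_cedges [set u | adj v u] s.
  have -> : count (mem [set u | adj v u]) s = degree adj v.
    rewrite degree_count -(permP s0P) /= adjI add0n (permP sP).
    by apply: eq_count => u; rewrite !inE.
  rewrite (perm_size sP); have := deg v; rewrite cardE -(perm_size s0P) /=.
  by rewrite -[count D _]/(count (fun e : {set V} => e \subset [set u | adj v u]) _); lia.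
have [|u _|||||r [g [rP rC rz gs [Dg gr]]]] :=
  @chord_cycle V adj D s z1 z2 adjC adjI _ _ sC cD.
- by rewrite (perm_uniq sP).
- exact: degs.
- exact: in_s.
- exact: in_s.
- by [].
- by rewrite /= subUset !sub1set !inE vz1 vz2.
have rP0 : perm_eq r s0 by apply: perm_trans rP sP.
rewrite (gainE r) //.
have gE : g \in edges adj.
  by move: rC; rewrite cycle_cedges // => /allP; apply.
case/imsetP: gE Dg gs gr => [[w1 w2] _ /= ->].
rewrite subUset !sub1set !inE => /andP[vw1 vw2] ws wr.
by rewrite -(gainE r w1 w2) // -(gainE s w1 w2).
Qed.

Lemma odd_cycle_sum (V : finType) (adj : rel V) (f : {set V} -> int) s :
  symmetric adj -> irreflexive adj -> edge_labelling adj f ->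
  cycle adj s -> odd (size s) -> cycle_sum f s != 0.
Proof.
move=> adjC adjI lab; rewrite cycle_cedges // -size_cedges /cycle_sum.
move: (cedges s) => l /allP lE ol.
have [k ->] : exists k, \sum_(e <- l) f e = (size l)%:Z + 2 * k.
  elim: l {ol} lE => [|e l IH] lE; first by exists 0; rewrite big_nil.
  have [k E] := IH (fun x xl => lE x (mem_behead (s := e :: l) xl)).
  rewrite big_cons E /=; case: (lab e (lE e (mem_head _ _))) => ->.
    by exists (k - 1); lia.
  by exists k; lia.
by apply/eqP; move: ol; lia.
Qed.

(** * Degrees and Hamilton cycles *)

Lemma min_degree_le (V : finType) (adj : rel V) v :
  (min_degree adj <= degree adj v)%N.
Proof.
rewrite /min_degree; have := mem_index_enum v.
elim: (index_enum V) => //= u l IH; rewrite inE big_cons => /predU1P[->|/IH h].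
  exact: geq_minl.
by rewrite geq_min h orbT.
Qed.

Lemma degree_lt (V : finType) (adj : rel V) v :
  irreflexive adj -> (degree adj v < #|V|)%N.
Proof.
move=> adjI; rewrite /degree -cardsT; apply: proper_card; rewrite properT.
by apply/eqP => /setP/(_ v); rewrite !inE adjI.
Qed.

Lemma hamilton_discrepancy (V : finType) (adj : rel V) (f : {set V} -> int) s :
  perm_eq s (enum V) -> cycle adj s -> (2 < #|V|)%N ->
  hamilton_cycle adj s /\ discrepancy f (cycle_edges s) = `|cycle_sum f s|.
Proof.
move=> sP sC gt2; have Us : uniq s by rewrite (perm_uniq sP) enum_uniq.
have sz : size s = #|V| by rewrite (perm_size sP) cardE.
split.
  rewrite /hamilton_cycle sz gt2 /ucycleb sC Us /=.
  by apply/forallP => v; rewrite (perm_mem sP) mem_enum.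
rewrite /discrepancy /cycle_sum cycle_edgesE //; congr `|_|.
rewrite [RHS]big_uniq ?cedges_uniq ?sz //=.
by apply: eq_bigl => e; rewrite inE.
Qed.

Lemma dirac_cycle (V : finType) (adj : rel V) :
  symmetric adj -> irreflexive adj -> (forall u, #|V| <= 2 * degree adj u)%N ->
  exists2 s, perm_eq s (enum V) & cycle adj s.
Proof.
move=> adjC adjI deg.
have [|||s [sP sC _]] := @posa_cycle V adj [::] (enum V) adjC adjI (enum_uniq _).
- by move=> u _; rewrite addn0 -degree_count -cardE.
- by [].
- by [].
by exists s.
Qed.

(** Distinct edges at [v] have distinct other ends, and [X] is too small to contain all of these. *)
Lemma label_neighbour (V : finType) (adj : rel V) (f : {set V} -> int)
    (X : {set V}) a v :
  symmetric adj -> irreflexive adj -> (#|X| < label_degree adj f a v)%N ->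
  exists2 u, u \notin X & adj v u /\ f [set v; u] = a.
Proof.
move=> adjC adjI lt; pose Na := [set u | adj v u && (f [set v; u] == a)].
have le : (label_degree adj f a v <= #|Na|)%N.
  rewrite /label_degree.
  have /subset_leq_card/leq_trans-> // :
    [set e in edges adj | (v \in e) && (f e == a)] \subset
      [set [set v; u] | u in Na]; last exact: leq_imset_card.
  apply/subsetP => e; rewrite inE => /andP[/imsetP[[x y]]].
  rewrite inE /= => xy -> /andP[/set2P[] vE fa]; subst v.
    by apply/imsetP; exists y; rewrite // inE xy.
  by apply/imsetP; exists x; rewrite 1?set2C // inE adjC xy set2C.
have /subsetPn[u uN uX] : ~~ (Na \subset X).
  by apply/negP => /subset_leq_card; lia.
by move: uN; rewrite inE => /andP[vu /eqP fu]; exists u.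
Qed.

(** Two neighbourhoods meet in more than [#|X|] vertices, which yields common neighbours outside
    [X]. Then any Hamilton cycle will do, with [B :\: X] as the set whose inner edges share a
    label. *)
Lemma rigid_cycle (V : finType) (adj : rel V) (f : {set V} -> int)
    (X B : {set V}) :
  symmetric adj -> irreflexive adj -> edge_labelling adj f -> rigid adj f X ->
  (forall u, #|V| + #|X| < 2 * degree adj u)%N ->
  (forall (v : V) (a : int), v \in B -> a = 1 \/ a = -1 ->
     (#|X| < label_degree adj f a v)%N) ->
  exists s, [/\ perm_eq s (enum V), cycle adj s &
    (4 * #|B|)%:Z - (4 * #|X| + 3 * #|V|)%:Z <= `|cycle_sum f s|].
Proof.
move=> adjC adjI lab rig deg bal.
have common x y : x \notin X -> y \notin X ->
    exists2 z, z \notin X & adj x z && adj y z.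
  move=> _ _; pose N u := [set w | adj u w].
  have /subsetPn[z zN zX] : ~~ (N x :&: N y \subset X).
    have arith (a b i j k l : nat) : (i + j = a + b -> i <= k -> j <= l ->
      k + l < 2 * a -> k + l < 2 * b -> False)%N by lia.
    apply/negP => /subset_leq_card le.
    exact: arith (cardsUI (N x) (N y)) (max_card _) le (deg x) (deg y).
  by exists z => //; move: zN; rewrite !inE.
have [v a vB _ aP|a aP Ba] := @rigid_label V adj f X B adjC adjI lab rig common.
  by apply: label_neighbour => //; apply: bal.
have [u|s sP sC] := dirac_cycle adjC adjI.
  by have := deg u; lia.
exists s; split=> //.
apply: le_trans (label_cycle_sum adjC adjI lab aP Ba sP sC).
have := cardsID X B; have := subset_leq_card (subsetIr B X).
by lia.
Qed.

(** * Choice of the number of switches and case distinction *)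

Theorem theorem1p2 (R : realType) (c d nu : R)
  (c_gt0 : 0 < c) (d_gt0 : 0 < d) (nu_gt0 : 0 < nu)
  (c_ge : 8 * nu <= c) (d_ge : 4 * nu <= d)
  (n : nat) (n_gt0 : (0 < n)%N)
  (V : finType) (order_V : #|V| = n)
  (adj : rel V) (adj_sym : symmetric adj) (adj_irr : irreflexive adj)
  (min_deg : (1 / 2 + c) * n%:R <= (min_degree adj)%:R)
  (f : {set V} -> int) (f_lab : edge_labelling adj f)
  (many_balanced :
     (3 / 4 + d) * n%:R <= #|[set v | balanced adj f nu v]|%:R) :
  exists H : seq V,
    hamilton_cycle adj H /\
    nu ^+ 2 * n%:R / 500 <= (discrepancy f (cycle_edges H))%:~R.
Proof.
have gt2 (i j : nat) : (i < j -> j < 2 * i -> 2 < j)%N by lia.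
have ge2 (i j k : nat) : ~~ odd i -> (i < 2 * j -> j <= k -> i + 2 <= 2 * k)%N by lia.
have half_l (x y : int) (i : nat) : y + i%:Z <= x -> 2 * `|x| < i%:Z ->
  i%:Z <= 2 * `|y| by lia.
set m := min_degree adj in min_deg.
have deg u : (m <= degree adj u)%N by exact: min_degree_le.
have nR : 0 < n%:R :> R by rewrite ltr0n.
have [v0 _] : exists v0 : V, v0 \in V by apply/card_gt0P; rewrite order_V.
have mn : (m < n)%N.
  by rewrite -order_V (leq_ltn_trans (deg v0)) // degree_lt.
have mnR : m%:R <= n%:R :> R by rewrite ler_nat ltnW.
set A := nu * n%:R.
have A_gt0 : 0 < A by rewrite mulr_gt0.
have cA : 8 * A <= c * n%:R by rewrite mulrA ler_wpM2r // ltW.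
have dA : 4 * A <= d * n%:R by rewrite mulrA ler_wpM2r // ltW.
set Q := nu ^+ 2 * n%:R.
have Q_ge0 : 0 <= Q by rewrite mulr_ge0 ?exprn_ge0 // ltW.
(* The minimum degree is at most [n], so [c <= 1 / 2], and [8 * nu <= c]. *)
have nu_le : nu <= 1 / 16.
  by rewrite -(ler_pM2r nR); move: min_deg cA; rewrite -/A mulrDl; lra.
have QA : Q <= A / 16.
  have -> : Q = nu * A by rewrite /Q /A expr2 mulrA.
  by rewrite mulrC; have := ler_wpM2l (ltW A_gt0) nu_le; lra.
have mR : n%:R / 2 + 8 * A <= m%:R by move: min_deg; rewrite mulrDl; lra.
have bR : 3 * n%:R / 4 + 4 * A <= #|[set v | balanced adj f nu v]|%:R.
  by move: many_balanced; rewrite mulrDl; lra.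
have m_gt : (n < 2 * m)%N by rewrite -(ltr_nat R) natrM; lra.
have n_gt2 : (2 < #|V|)%N by rewrite order_V (gt2 m).
(* With [k.+1 > Q / 250] switches, one of two sums differing by [k.+1] has absolute value above
   [Q / 500]. A rigid labelling loses only the [5 * k] vertices of [X], at most [Q / 50]. *)
pose k := Num.truncn (Q / 250).
have /andP[kQ Qk] : k%:R <= Q / 250 < k.+1%:R.
  by apply: truncn_itv; lra.
rewrite -[k.+1%:R]natr1 in Qk.
have finish s x : perm_eq s (enum V) -> cycle adj s -> Q / 500 <= x%:~R ->
    x <= `|cycle_sum f s| -> exists H : seq V,
    hamilton_cycle adj H /\ Q / 500 <= (discrepancy f (cycle_edges H))%:~R.
  move=> sP sC Qx xs; exists s.
  have [sH ->] := hamilton_discrepancy f sP sC n_gt2; split=> //.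
  by apply: le_trans Qx _; rewrite ler_int.
have use_rigid (X : {set V}) : (#|X| <= 5 * k)%N -> rigid adj f X ->
    exists H : seq V,
    hamilton_cycle adj H /\ Q / 500 <= (discrepancy f (cycle_edges H))%:~R.
  rewrite -(ler_nat R) natrM => Xk rX.
  have [u|v a|s [sP sC sS]] :=
    @rigid_cycle V adj f X [set v | balanced adj f nu v] adj_sym adj_irr f_lab rX.
  - apply: (@leq_trans (2 * m)); last by rewrite leq_mul2l deg.
    by rewrite order_V -(ltr_nat R) natrD natrM; lra.
  - rewrite inE => /andP[]; rewrite order_V -/A => b1 b2 [] ->.
      by rewrite -(ltr_nat R); lra.
    by rewrite -(ltr_nat R); lra.
  (* The bound is at least [16 * A - 20 * k], far above [Q / 500]. *)
  apply: finish sP sC _ sS; rewrite order_V rmorphB /= -!pmulrn !(natrM, natrD).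
  by lra.
have [big|small] := leqP (n + 3 * k.+1) (2 * m).
  have [[L [szL swL UL]]|[X Xk rX]] := @switches_or_rigid V adj f k adj_sym adj_irr;
    last exact: use_rigid rX.
  have [u|t1 [t2 [/andP[t1P t2P] t1C t2C ts]]] :=
    switch_cycles adj_sym adj_irr swL UL.
    by rewrite order_V szL (leq_trans big) // leq_mul2l deg.
  have half (x : int) : k.+1%:Z <= 2 * x -> Q / 500 <= x%:~R.
    rewrite -(ler_int R) intrM -pmulrn -[k.+1%:R]natr1 => h.
    by move: h; rewrite -[2%:~R]/(2 : R); lra.
  have [h1|h1] := leP (k.+1%:Z) (2 * `|cycle_sum f t1|).
    by apply: finish t1P t1C (half _ h1) (lexx _).
  apply: finish t2P t2C (half _ _) (lexx _).
  by apply: half_l h1; rewrite -szL.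
(* For [k >= 1] one has [3 * k.+1 <= 6 * k <= 16 * A], and the degree condition would hold. With
   [k = 0], [Q / 500 < 1 / 2], so a nonzero sum suffices. *)
have k0 : k = 0%N.
  apply/eqP; apply: contraTT small; rewrite -lt0n -(ltr_nat R) -leqNgt => k_gt0.
  have k1 : 1 <= k%:R :> R by rewrite ler1n -(ltr_nat R).
  by rewrite -(ler_nat R) natrD !natrM -[k.+1%:R]natr1; lra.
rewrite k0 in Qk.
have nonzero s : perm_eq s (enum V) -> cycle adj s -> cycle_sum f s != 0 ->
    exists H : seq V,
    hamilton_cycle adj H /\ Q / 500 <= (discrepancy f (cycle_edges H))%:~R.
  move=> sP sC s0; apply: (finish s 1 sP sC); first by lra.
  by rewrite -gtz0_ge1 normr_gt0.
have [n_odd|n_even] := boolP (odd n).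
  have [u|s sP sC] := dirac_cycle adj_sym adj_irr.
    by rewrite order_V (leq_trans (ltnW m_gt)) // leq_mul2l deg.
  apply: (nonzero s sP sC); apply: odd_cycle_sum sC _ => //.
  by rewrite (perm_size sP) -cardE order_V.
(* The Hamilton cycles are searched among the finitely many orderings of [V]. If all their sums
   vanish, the labelling is rigid with [X] empty. *)
have [/hasP[s]|/hasPn all0] := boolP (has
  (fun s => cycle adj s && (cycle_sum f s != 0)) (permutations (enum V))).
  by rewrite mem_permutations => sP /andP[]; apply: nonzero.
apply: (use_rigid set0); first by rewrite cards0.
apply: (constant_sum_rigid (a := 0)) => // [u|s sP sC].
  by rewrite order_V; apply: ge2 n_even m_gt (deg u).
have := all0 s; rewrite mem_permutations => /(_ sP).
by rewrite sC negbK => /eqP.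
Qed.
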